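(* Let $q=p^f$ be a prime power and $n=2m$ an even positive integer. Let $Q:V=\mathbb{F}_q^n\to\mathbb{F}_q$ be a nonsingular quadratic form. Let $e\mid(q-1)$, let $\omega$ be a primitive element of $\mathbb{F}_q$, and let $C_i^{(e,q)}=\omega^i\langle\omega^e\rangle$, $0\le i\le e-1$. Let $D_0=\{x\in V: Q(x)=0\}$ and $D_{C_i^{(e,q)}}=\{x\in V:Q(x)\in C_i^{(e,q)}\}$. Then the decomposition of the complete graph on $V$ into $\mathrm{Cay}(V,D_0\setminus\{0\})$ and $\mathrm{Cay}(V,D_{C_i^{(e,q)}})$, $0\le i\le e-1$, gives an $(e+1)$-class association scheme.
   Context: A (symmetric) association scheme with $d$ classes on a finite set $X$ is a partition of $X\times X$ into relations $R_0,\ldots,R_d$ with $R_0=\{(x,x):x\in X\}$, each $R_i$ symmetric, and such that for all $i,j,k$ there is an integer $p_{ij}^k$ with $|\{z:(x,z)\in R_i,(z,y)\in R_j\}|=p_{ij}^k$ for every $(x,y)\in R_k$; a decomposition of the complete graph on $X$ into graphs $G_1,\dots,G_d$ gives an association scheme if the edge relations of the $G_i$ together with $R_0$ form one. A Cayley graph $\mathrm{Cay}(V,D)$ ($0\notin D=-D$) has $x\sim y$ iff $x-y\in D$. A quadratic form $Q$ satisfies $Q(\alpha v)=\alpha^2Q(v)$ with $Q(u+v)-Q(u)-Q(v)$ bilinear; it is nonsingular if it cannot be written in fewer than $n$ variables after an invertible linear change of variables. *)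

(* Defs.v *)
From HB Require Import structures.
From mathcomp Require Import all_boot all_order all_algebra.
From mathcomp Require Import all_fingroup all_solvable.

Set Implicit Arguments.
Unset Strict Implicit.
Unset Printing Implicit Defensive.

Import GRing.Theory.
Local Open Scope ring_scope.

(* Parts of the partition are allowed to be empty here: nonemptiness is to be
   asserted separately, since for an anisotropic binary form no nonzero vector
   has value 0. *)
Definition assoc_scheme (X : finType) (d : nat)
    (R : 'I_d.+1 -> {set X * X}) : Prop :=
  [/\ R ord0 = [set u | u.1 == u.2],
      forall x y : X, exists! i : 'I_d.+1, (x, y) \in R i,
      forall (i : 'I_d.+1) (x y : X), (x, y) \in R i -> (y, x) \in R i
    & forall i j k : 'I_d.+1, exists c : nat, forall x y : X,
        (x, y) \in R k ->
        #|[set z | ((x, z) \in R i) && ((z, y) \in R j)]| = c].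

(* R_0 is the diagonal and R_(j+1) is the edge relation of the j-th graph. *)
Definition graph_relations (X : finType) (d : nat) (G : 'I_d -> rel X)
    (i : 'I_d.+1) : {set X * X} :=
  if unlift ord0 i is Some j then [set u | G j u.1 u.2]
  else [set u | u.1 == u.2].

Definition gives_assoc_scheme (X : finType) (d : nat) (G : 'I_d -> rel X) :
    Prop :=
  assoc_scheme (graph_relations G).

Definition cayley (V : finZmodType) (D : {set V}) : rel V :=
  [rel x y | x - y \in D].

Section QuadraticForms.

Variable F : fieldType.

Definition polar (n : nat) (Q : 'rV[F]_n -> F) (u v : 'rV[F]_n) : F :=
  Q (u + v) - Q u - Q v.

Definition quadratic_form (n : nat) (Q : 'rV[F]_n -> F) : Prop :=
  [/\ forall (a : F) (v : 'rV[F]_n), Q (a *: v) = a ^+ 2 * Q v,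
      forall u : 'rV[F]_n, scalar (polar Q u)
    & forall v : 'rV[F]_n, scalar (polar Q ^~ v)].

(* After the change of variables A, Q is a quadratic form in the first k
   coordinates only. *)
Definition written_in_vars (n : nat) (Q : 'rV[F]_n -> F) (k : nat)
    (le_kn : (k <= n)%N) : Prop :=
  exists A : 'M[F]_n, A \in unitmx /\
  exists Q' : 'rV[F]_k -> F, quadratic_form Q' /\
  forall v : 'rV[F]_n, Q (v *m A) = Q' (\row_i v 0 (widen_ord le_kn i)).

Definition nonsingular (n : nat) (Q : 'rV[F]_n -> F) : Prop :=
  forall (k : nat) (lt_kn : (k < n)%N), ~ written_in_vars Q (ltnW lt_kn).

End QuadraticForms.

Section Cyclotomy.

Variable F : finFieldType.

Definition cyclotomic_class (w : {unit F}) (e i : nat) : {set F} :=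
  [set FinRing.uval u | u in ((w ^+ i) *: <[w ^+ e]>)%g].

Definition zero_set (n : nat) (Q : 'rV[F]_n -> F) : {set 'rV[F]_n} :=
  [set x | Q x == 0].

Definition value_set (n : nat) (Q : 'rV[F]_n -> F) (C : {set F}) :
    {set 'rV[F]_n} :=
  [set x | Q x \in C].

(* The e + 1 graphs: index 0 is Cay(V, D_0 \ {0}), and index i + 1 is
   Cay(V, D_(C_i)). *)
Definition quadric_graphs (n : nat) (Q : 'rV[F]_n -> F) (w : {unit F})
    (e : nat) (i : 'I_e.+1) : rel 'rV[F]_n :=
  if unlift ord0 i is Some j then cayley (value_set Q (cyclotomic_class w e j))
  else cayley (zero_set Q :\ 0).

End Cyclotomy.

(* Main.v *)
Require Import Defs.
From HB Require Import structures.
From mathcomp Require Import all_boot all_order all_algebra.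
From mathcomp Require Import all_fingroup all_solvable.
From mathcomp Require Import ring zify.

Set Implicit Arguments.
Unset Strict Implicit.
Unset Printing Implicit Defensive.

Import GRing.Theory.
Local Open Scope ring_scope.

(** For [n] even the polar form [B] of [Q] is nondegenerate (in
    characteristic 2 the radical has dimension at most 1 and even codimension).
    Let A(c) be the number of solutions of Q x = c.  Splitting off hyperbolic
    planes reduces A to that of an anisotropic form, where comparing the first
    two moments of A shows that the dimension is at most 2 and that A is constant
    on nonzero values; hence A(l c) = A(c) for every nonzero l.  For w != 0,
    counting the pairs (z, b) with Q (z + b w) = c + b t + b^2 Q w in two ways
    gives
      q^n + q #{z | Q z = c, B w z = t}
        = q^(n-1) + sum_b A(c + b t + b^2 Q w),
    so the left-hand count depends only on (c, t, Q w) up to a common nonzero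
    factor.  Therefore so does the number of z with Q z = a, Q (w - z) = b, and
    summing over cosets of a subgroup of the multiplicative group makes the
    intersection numbers constant. *)

(** * Double counting in finite sets *)

Lemma card_set1_cond (T : finType) (u : T) (b : bool) :
  #|[set z in [set u] | b]| = b.
Proof.
case: b; last by apply: eq_card0 => z; rewrite inE andbF.
by rewrite -[RHS](cards1 u); apply: eq_card => z; rewrite inE andbT.
Qed.

Lemma card_set_sum (T : finType) (P : pred T) :
  #|[set z | P z]| = (\sum_z P z)%N.
Proof.
rewrite -sum1_card big_mkcond; apply: eq_bigr => z _; rewrite inE.
by case: (P z).
Qed.

Lemma card_fibers (T : finType) (rT : finType) (U : {set T}) (g : T -> rT) :
  #|U| = (\sum_c #|[set x in U | g x == c]|)%N.
Proof.
rewrite -sum1_card (partition_big g predT) //=.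
apply: eq_bigr => c _; rewrite -sum1_card.
by apply: eq_bigl => x; rewrite inE.
Qed.

Lemma card_pair_fibers (T : finType) (P : T -> T -> bool) (U : {set T}) :
  #|[set u : T * T | [&& u.1 \in U, u.2 \in U & P u.1 u.2]]| =
  (\sum_(x in U) #|[set y in U | P x y]|)%N.
Proof.
rewrite -sum1_card.
rewrite (eq_bigl (fun u => (u.1 \in U) && ((u.2 \in U) && P u.1 u.2))).
  rewrite -(pair_big_dep (fun x => x \in U) (fun x y => (y \in U) && P x y)
              (fun _ _ => 1%N)) /=.
  apply: eq_bigr => x _; rewrite -sum1_card; apply: eq_bigl => y.
  by rewrite inE.
by move=> u; rewrite inE.
Qed.

(** * Identities for a quadratic form and its polar form *)

Section PolarForm.

Variables (F : fieldType) (n : nat) (Q : 'rV[F]_n -> F).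
Hypothesis Q_quad : quadratic_form Q.
Local Notation B := (polar Q).

Lemma qformD x y : Q (x + y) = Q x + Q y + B x y.
Proof. by rewrite /polar; ring. Qed.

Lemma qformZ a x : Q (a *: x) = a ^+ 2 * Q x.
Proof. by case: Q_quad. Qed.

Lemma qform0 : Q 0 = 0.
Proof. by rewrite -(scale0r 0) qformZ expr0n mul0r. Qed.

Lemma qformN x : Q (- x) = Q x.
Proof. by rewrite -scaleN1r qformZ sqrrN expr1n mul1r. Qed.

Lemma polarC x y : B x y = B y x.
Proof. by rewrite /polar (addrC y) addrAC. Qed.

Lemma polar_linear u a x y : B u (a *: x + y) = a * B u x + B u y.
Proof. by case: Q_quad => _ Bl _; apply: Bl. Qed.

Lemma polarDr u x y : B u (x + y) = B u x + B u y.
Proof. by rewrite -[x in LHS]scale1r polar_linear mul1r. Qed.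

Lemma polarv0 u : B u 0 = 0.
Proof. by rewrite /polar addr0 qform0 subr0 subrr. Qed.

Lemma polarZr u a x : B u (a *: x) = a * B u x.
Proof. by rewrite -[a *: x]addr0 polar_linear polarv0 addr0. Qed.

Lemma polarNr u x : B u (- x) = - B u x.
Proof. by rewrite -scaleN1r polarZr mulN1r. Qed.

Lemma polarDl u x y : B (x + y) u = B x u + B y u.
Proof. by rewrite !(polarC _ u) polarDr. Qed.

Lemma polarZl u a x : B (a *: x) u = a * B x u.
Proof. by rewrite !(polarC _ u) polarZr. Qed.

Lemma polarNl u x : B (- x) u = - B x u.
Proof. by rewrite !(polarC _ u) polarNr. Qed.

Lemma polar0v u : B 0 u = 0.
Proof. by rewrite polarC polarv0. Qed.

Lemma polarxx x : B x x = Q x *+ 2.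
Proof.
rewrite /polar -mulr2n -scaler_nat qformZ -mulr_natl; ring.
Qed.

Lemma qformB x y : Q (x - y) = Q x + Q y - B x y.
Proof. by rewrite qformD qformN polarNr. Qed.

End PolarForm.

(** * Level sets on subspaces and the first two moments of the value count *)

Section Subspaces.

Variables (F : finFieldType) (n : nat) (Q : 'rV[F]_n -> F).
Hypothesis Q_quad : quadratic_form Q.
Local Notation B := (polar Q).
Local Notation q := #|F|.
Implicit Types (U : {set 'rV[F]_n}) (x y u v w z : 'rV[F]_n) (a b c t : F).

Definition subspace_set U : Prop :=
  0 \in U /\ forall a x y, x \in U -> y \in U -> a *: x + y \in U.

Definition nondegenerate_on U : Prop :=
  forall v, v \in U -> v != 0 -> exists2 u, u \in U & B v u != 0.

Definition qcount U c : nat := #|[set x in U | Q x == c]|.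

Lemma subspace_setD U x y :
  subspace_set U -> x \in U -> y \in U -> x + y \in U.
Proof. by move=> [_ UL] xU yU; rewrite -[x]scale1r UL. Qed.

Lemma subspace_setZ U a x : subspace_set U -> x \in U -> a *: x \in U.
Proof. by move=> [U0 UL] xU; rewrite -[_ *: _]addr0 UL. Qed.

Lemma subspace_setN U x : subspace_set U -> x \in U -> - x \in U.
Proof. by move=> Us; rewrite -scaleN1r; apply: subspace_setZ. Qed.

Lemma subspace_setB U x y :
  subspace_set U -> x \in U -> y \in U -> x - y \in U.
Proof. by move=> Us xU yU; rewrite subspace_setD // subspace_setN. Qed.

Lemma subspace_setT : subspace_set [set: 'rV[F]_n].
Proof. by split=> *; rewrite inE. Qed.

(** Translation by a suitable multiple of [u] carries the level [s] onto the level [t], so all [q]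
    levels have equal size. *)
Lemma card_level_set U (phi : 'rV[F]_n -> F) t :
    subspace_set U -> scalar phi -> (exists2 u, u \in U & phi u != 0) ->
  (q * #|[set x in U | phi x == t]| = #|U|)%N.
Proof.
move=> Us phiL [u uU phiu]; rewrite (card_fibers U phi).
rewrite (eq_bigr (fun=> #|[set x in U | phi x == t]|)); last first.
  move=> s _; pose d := ((t - s) / phi u) *: u.
  have dU : d \in U by apply: subspace_setZ.
  have phid x : phi (d + x) = t - s + phi x by rewrite phiL /= divfK.
  rewrite -(card_imset [set x in U | phi x == s] (addrI d)).
  apply: eq_card => y; rewrite !inE; apply/imsetP/andP.
    case=> x; rewrite inE => /andP[xU /eqP phix] ->.
    by rewrite subspace_setD // phid phix subrK.
  case=> yU /eqP phiy; exists (y - d); last by rewrite addrC subrK.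
  rewrite inE subspace_setB //=; apply/eqP/(addrI (t - s)).
  by rewrite -phid addrC subrK phiy subrK.
by rewrite sum_nat_const.
Qed.

Lemma card_hyperplane U v t :
  subspace_set U -> (exists2 u, u \in U & B v u != 0) ->
  (q * #|[set x in U | B v x == t]| = #|U|)%N.
Proof. by move=> Us; apply: card_level_set => //; case: Q_quad => _ + _. Qed.

Lemma sum_qcount U : (\sum_c qcount U c = #|U|)%N.
Proof. by rewrite (card_fibers U Q). Qed.

(** The sum of squares counts pairs in [U] with equal value. In terms of one vector and the
    difference, equality of values is linear in the vector. The zero difference gives [#|U|] pairs,
    and by nondegeneracy any other gives [#|U| / q]. *)
Lemma sum_qcount_sq U :
  subspace_set U -> nondegenerate_on U ->
  (q * \sum_c qcount U c ^ 2 = q * #|U| + #|U|.-1 * #|U|)%N.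
Proof.
move=> Us Un; have U0 := Us.1.
have -> : (\sum_c qcount U c ^ 2 =
           \sum_(x in U) #|[set y in U | Q (y + x) == Q x]|)%N.
  transitivity (\sum_(x in U) qcount U (Q x))%N.
    rewrite (partition_big Q predT) //=; apply: eq_bigr => c _.
    rewrite (eq_bigr (fun=> qcount U c)); last by move=> x /andP[_ /eqP->].
    rewrite sum_nat_const -mulnn; congr (_ * _)%N.
    by apply: eq_card => x; rewrite !inE.
  apply: eq_bigr => x xU.
  rewrite -[RHS](card_imset _ (addIr x)); apply: eq_card => y.
  rewrite !inE; apply/andP/imsetP => [[yU Qy]|[z]].
    exists (y - x); last by rewrite subrK.
    by rewrite inE subspace_setB // subrK.
  by rewrite inE => /andP[zU Qz] ->; rewrite subspace_setD.
rewrite -(card_pair_fibers (fun x y => Q (y + x) == Q x)).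
have -> : #|[set u : 'rV[F]_n * 'rV[F]_n |
            [&& u.1 \in U, u.2 \in U & Q (u.2 + u.1) == Q u.1]]|
  = #|[set u : 'rV[F]_n * 'rV[F]_n |
        [&& u.1 \in U, u.2 \in U & B u.1 u.2 == - Q u.1]]|.
  have swapI : injective (fun u : 'rV[F]_n * 'rV[F]_n => (u.2, u.1)).
    by move=> [a b] [c d] [-> ->].
  rewrite -(card_imset _ swapI); apply: eq_card => -[x y]; apply/imsetP/idP.
    case=> -[x' y']; rewrite !inE /= => /and3P[xU yU Qe] [-> ->];
      rewrite xU yU /=.
    by move: Qe; rewrite qformD // -subr_eq0 -[_ == - _]subr_eq0 => /eqP<-; apply/eqP; ring.
  rewrite !inE /= => /and3P[xU yU /eqP Be]; exists (y, x) => //.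
  by rewrite inE /= xU yU qformD // Be; apply/eqP; ring.
rewrite (card_pair_fibers (fun x y => B x y == - Q x)) (bigD1 0) //= mulnDr.
congr (_ * _ + _)%N.
  apply: eq_card => y; rewrite !inE polar0v // qform0 // oppr0 eqxx.
  by rewrite andbT.
rewrite big_distrr /= (eq_bigr (fun=> #|U|)); last first.
  by move=> v /andP[vU v0]; apply: card_hyperplane => //; apply: Un.
rewrite sum_nat_const; congr (_ * _)%N.
rewrite (cardsD1 0 U) U0 /=; apply: eq_card => x.
by rewrite [LHS]inE !inE andbC.
Qed.

End Subspaces.

(** * Hyperbolic splitting and the value distribution in even dimension *)

Section Splitting.

Variables (F : finFieldType) (n : nat) (Q : 'rV[F]_n -> F).
Hypothesis Q_quad : quadratic_form Q.
Local Notation B := (polar Q).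
Local Notation q := #|F|.
Implicit Types (U : {set 'rV[F]_n}) (x y u v w z : 'rV[F]_n) (a b c t : F).

(** A variance argument: with [A] for [qcount Q U] and [A 0 = 1], the two moments show that the
    squares [((q-1) A c - (#|U|-1))^2], summed over [c != 0], give [(q-1) (#|U|-1) (q-L)]. Hence
    [L <= q], so [L = q] and every square vanishes. *)
Lemma qcount_anisotropic U L :
    subspace_set U -> nondegenerate_on Q U ->
    (forall x, x \in U -> Q x = 0 -> x = 0) ->
    #|U| = (q * L)%N -> (q <= L)%N ->
  L = q /\ forall c, c != 0 -> (q.-1 * qcount Q U c = #|U|.-1)%N.
Proof.
move=> Us Un Ua cU leL.
have q1 : (1 < q)%N by apply: card_finNzRing_gt1.
have U_gt0 : (0 < #|U|)%N by rewrite cU; nia.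
have c0 : qcount Q U 0 = 1%N.
  apply/eqP/cards1P; exists 0; apply/setP=> x; rewrite !inE.
  apply/andP/eqP => [[xU /eqP /(Ua _ xU)] //|->].
  by rewrite Us.1 qform0 ?eqxx.
have S1 := sum_qcount Q U; rewrite (bigD1 0) //= c0 in S1.
have S2 := sum_qcount_sq Q_quad Us Un; rewrite (bigD1 0) //= c0 in S2.
pose A c : int := (qcount Q U c)%:Z; pose K : int := #|U|%:Z.
pose qz : int := q%:Z; pose Lz : int := L%:Z.
have S1z : \sum_(c | c != 0) A c = K - 1.
  by rewrite /A /K -S1 PoszD addrC addKr (big_morph Posz PoszD (erefl _)).
have KL : K = qz * Lz by rewrite /K cU PoszM.
have S2z : \sum_(c | c != 0) A c ^+ 2 = (K - 1) * (Lz + 1).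
  have S2' : qz * (1 + \sum_(c | c != 0) A c ^+ 2) = qz * K + (K - 1) * K.
    have -> : \sum_(c | c != 0) A c ^+ 2 =
        Posz (\sum_(c : F | c != 0%R) qcount Q U c ^ 2)%N.
      by rewrite (big_morph Posz PoszD (erefl _)); apply: eq_bigr => c _;
         rewrite /A; lia.
    have predU : Posz #|U|.-1 = K - 1 by rewrite /K; lia.
    by have := congr1 Posz S2; rewrite exp1n !(PoszM, PoszD) predU.
  have q0 : qz != 0 by rewrite /qz; lia.
  apply: (mulfI q0); apply: (addrI qz).
  by transitivity (qz * K + (K - 1) * K); [rewrite -S2' | rewrite KL]; ring.
have S3 : \sum_(c | c != 0) ((qz - 1) * A c - (K - 1)) ^+ 2 =
    (qz - 1) * (K - 1) * (qz - Lz).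
  transitivity (\sum_(c | c != 0) ((qz - 1) ^+ 2 * A c ^+ 2 -
     2%:R * (qz - 1) * (K - 1) * A c + (K - 1) ^+ 2)).
    by apply: eq_bigr => c _; ring.
  rewrite big_split /= sumrB -!big_distrr /= S1z S2z sumr_const.
  have -> : #|[pred c : F | c != 0]| = q.-1.
    by rewrite cardC1.
  rewrite -[_ *+ q.-1]mulr_natl.
  have -> : q.-1%:R = qz - 1 :> int by rewrite /qz; lia.
  by rewrite KL; ring.
have S4 : 0 <= \sum_(c | c != 0) ((qz - 1) * A c - (K - 1)) ^+ 2.
  by apply: Num.Theory.sumr_ge0 => c _; apply: Num.Theory.sqr_ge0.
have Lq : L = q.
  have : qz - Lz >= 0.
    rewrite S3 Num.Theory.pmulr_rge0 // in S4.
    have U1 : (1 < #|U|)%N by rewrite cU; nia.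
    by apply: Num.Theory.mulr_gt0; rewrite /qz /K; lia.
  by rewrite /qz /Lz; lia.
split=> // c c0'.
have /eqP := S3; rewrite /Lz Lq subrr mulr0 Num.Theory.psumr_eq0; last first.
  by move=> ? _; apply: Num.Theory.sqr_ge0.
move=> /allP /(_ c (mem_index_enum _));
  rewrite c0' /= sqrf_eq0 subr_eq0 => /eqP.
have -> : qz - 1 = Posz q.-1 by rewrite /qz; lia.
by have -> : K - 1 = Posz #|U|.-1 by [rewrite /K; lia]; rewrite -PoszM => -[].
Qed.

Section Plane.

Variables (U : {set 'rV[F]_n}) (v u : 'rV[F]_n).
Hypotheses (Us : subspace_set U) (Un : nondegenerate_on Q U).
Hypotheses (vU : v \in U) (uU : u \in U).
Hypotheses (Bvv : B v v = 0) (Buu : B u u = 0) (Bvu : B v u = 1).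

Definition plane_perp : {set 'rV[F]_n} :=
  [set x in U | (B v x == 0) && (B u x == 0)].
Local Notation W := plane_perp.

Lemma plane_perpP w : w \in W -> [/\ w \in U, B v w = 0 & B u w = 0].
Proof. by rewrite inE => /and3P[-> /eqP-> /eqP->]. Qed.

Lemma plane_perp_subspace : subspace_set W.
Proof.
split=> [|a x y /plane_perpP[xU vx ux] /plane_perpP[yU vy uy]].
  by rewrite inE Us.1 !polarv0 ?eqxx.
by rewrite inE Us.2 // !polar_linear // vx ux vy uy mulr0 addr0 eqxx.
Qed.

(** The components of [x] along [v] and [u] are [B u x] and [B v x]; each fibre of this pair of
    functions is a translate of [W]. *)
Lemma card_plane_split (P : pred 'rV[F]_n) :
  #|[set x in U | P x]| =
  (\sum_a \sum_b #|[set x in W | P (x + (a *: v + b *: u))%R]|)%N.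
Proof.
rewrite (card_fibers _ (fun x => (B u x, B v x))) pair_bigA /=.
apply: eq_bigr => -[a b] _ /=.
set d := a *: v + b *: u.
have dU : d \in U by rewrite Us.2 // subspace_setZ.
have Bud : B u d = a.
  by rewrite polarDr // !polarZr // Buu polarC Bvu mulr1 mulr0 addr0.
have Bvd : B v d = b by rewrite polarDr // !polarZr // Bvv Bvu mulr0 add0r mulr1.
clearbody d; rewrite -[RHS](card_imset _ (addIr d)); apply: eq_card => x.
rewrite !inE -andbA; apply/and3P/imsetP => [[xU Px]|[y]].
  rewrite xpair_eqE => /andP[/eqP ux /eqP vx].
  exists (x - d); last by rewrite subrK.
  rewrite !inE subrK Px subspace_setB //= !polarDr // !polarNr // ux vx Bud Bvd.
  by rewrite !subrr eqxx.
rewrite !inE => /andP[/and3P[yU /eqP vy /eqP uy] Py] ->.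
by rewrite subspace_setD // xpair_eqE !polarDr // vy uy Bud Bvd !add0r !eqxx.
Qed.

Lemma card_plane_perp : #|U| = (q ^ 2 * #|W|)%N.
Proof.
have := card_plane_split predT; rewrite (eq_card (B := U)); last first.
  by move=> x; rewrite inE andbT.
move=> ->; rewrite (eq_bigr (fun=> q * #|W|)%N).
  by rewrite sum_nat_const mulnA.
move=> a _; rewrite -sum_nat_const; apply: eq_bigr => b _.
by apply: eq_card => x; rewrite inE andbT.
Qed.

(** Removing from a witness [x] its component in the plane puts it in [W] and keeps [B w x], as [w]
    is orthogonal to the plane. *)
Lemma plane_perp_nondegenerate : nondegenerate_on Q W.
Proof.
move=> w wW w0; have [wU vw uw] := plane_perpP wW.
have [x xU Bwx] := Un wU w0.
set a := B u x; set b := B v x; pose d := a *: v + b *: u.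
have Bwd : B w d = 0.
  by rewrite polarDr // !polarZr // !(polarC _ w) vw uw !mulr0 addr0.
exists (x - d); last by rewrite polarDr // polarNr // Bwd subr0.
rewrite inE subspace_setB ?Us.2 ?subspace_setZ //=.
rewrite !polarDr // !polarNr // !polarDr // !polarZr // Bvv Buu (polarC Q u v) Bvu.
by rewrite !mulr0 !mulr1 add0r addr0 !subrr eqxx.
Qed.

(** For [x] in [W], the value at [x + (a *: v + b *: u)] is [Q x + a * b]. If [a != 0], then
    [c - a * b] runs over the whole field with [b], which gives [#|W|]; if [a = 0], each [b] gives
    [qcount Q W c]. *)
Lemma qcount_hyperbolic c : Q v = 0 -> Q u = 0 ->
  qcount Q U c = (q.-1 * #|W| + q * qcount Q W c)%N.
Proof.
move=> Qv Qu; rewrite /qcount card_plane_split.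
transitivity (\sum_a \sum_b qcount Q W (c - a * b)%R)%N.
  apply: eq_bigr => a _; apply: eq_bigr => b _.
  apply: eq_card => x; rewrite [LHS]inE [RHS]inE.
  case: (boolP (x \in W)) => [xW|//]; have [_ vx ux] := plane_perpP xW;
    rewrite /=.
  rewrite 2!qformD (qformZ Q_quad a v) (qformZ Q_quad b u) Qv Qu.
  rewrite polarDr // !polarZr // polarZl // !(polarC _ x) vx ux Bvu !mulr0 !addr0 !add0r mulr1.
  by rewrite [RHS]eq_sym subr_eq eq_sym mulrC.
rewrite (bigD1 0) //= addnC; congr (_ + _)%N.
  rewrite (eq_bigr (fun=> #|W|)); first by rewrite sum_nat_const cardC1.
  move=> a a0; rewrite -(sum_qcount Q W); symmetry.
  rewrite (reindex (fun b => c - a * b)) //.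
  exists (fun t => (c - t) / a) => b _.
    by rewrite opprB addrC subrK mulrC mulKf.
  by rewrite mulrC divfK // opprB addrC subrK.
rewrite -sum_nat_const; apply: eq_bigr => b _.
by rewrite mul0r subr0.
Qed.

End Plane.

(** Induction on [m]: a nonzero singular vector extends to a hyperbolic pair, and
    [qcount_hyperbolic] passes the claim to a complement of dimension smaller by 2; without such a
    vector the anisotropic case applies. *)
Lemma qcount_const U m c c' :
    subspace_set U -> nondegenerate_on Q U -> #|U| = (q ^ m.*2)%N ->
  c != 0 -> c' != 0 -> qcount Q U c = qcount Q U c'.
Proof.
move=> + + + c0 c0'; have q1 : (1 < q)%N by apply: card_finNzRing_gt1.
elim: m U => [|m IHm] U Us Un cU.
  have /eqP/cards1P[x Ux] := cU.
  have U0 : U = [set 0] by move: Us.1; rewrite Ux inE => /eqP->.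
  have z d : d != 0 -> qcount Q U d = 0%N.
    move=> d0; apply/eqP; rewrite cards_eq0; apply/eqP/setP=> y.
    rewrite !inE U0 inE; apply/negP => /andP[/eqP-> ].
    by rewrite qform0 // eq_sym (negPf d0).
  by rewrite !z.
have [/forall_inP Ua | /forall_inPn[v vU]] :=
    boolP [forall x in U, (Q x == 0) ==> (x == 0)].
  have qL : (q <= q ^ m.*2.+1)%N by rewrite expnS leq_pmulr // expn_gt0 ltnW.
  have [||_ H] := @qcount_anisotropic U (q ^ m.*2.+1) Us Un _ _ qL.
  - by move=> x /Ua /implyP H /eqP/H/eqP.
  - by rewrite cU doubleS -expnS.
  have : (q.-1 * qcount Q U c = q.-1 * qcount Q U c')%N by rewrite !H.
  by move/eqP; rewrite eqn_pmul2l ?(eqP) => [/eqP//|]; lia.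
rewrite negb_imply => /andP[/eqP Qv v0].
have [u0 u0U Bvu0] := Un v vU v0.
(* Once [B v u1 = 1], subtracting [Q u1 *: v] makes the vector singular:
   [Q u = Q u1 - Q u1 * B u1 v = 0]. *)
pose u1 := (B v u0)^-1 *: u0; pose u := u1 - Q u1 *: v.
have u1U : u1 \in U by apply: subspace_setZ.
have uU : u \in U by rewrite subspace_setB // subspace_setZ.
have Bvv : B v v = 0 by rewrite polarxx // Qv mul0rn.
have Bvu1 : B v u1 = 1 by rewrite polarZr // mulVf.
have Bvu : B v u = 1.
  by rewrite polarDr // polarNr // (polarZr Q_quad v (Q u1)) Bvv mulr0 subr0.
have Qu : Q u = 0.
  by rewrite qformB // (qformZ Q_quad _ v) Qv (polarZr Q_quad _ _ v) polarC Bvu1; ring.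
have Buu : B u u = 0 by rewrite polarxx // Qu mul0rn.
rewrite !(qcount_hyperbolic Us vU uU) //; congr (_ + _ * _)%N.
apply: IHm.
- exact: plane_perp_subspace.
- exact: plane_perp_nondegenerate.
have := card_plane_perp Us vU uU Bvv Buu Bvu.
rewrite cU doubleS -addn2 addnC expnD => /eqP.
by rewrite eqn_pmul2l ?expn_gt0 ?(ltnW q1) // => /eqP->.
Qed.

(** When [B] is alternating, any [v] and [u] with [B v u = 1] span a plane that splits off, so the
    dimension drops by 2 until only the zero space is left. *)
Lemma alternating_even_dim U k :
    subspace_set U -> nondegenerate_on Q U -> (forall x, B x x = 0) ->
  #|U| = (q ^ k)%N -> ~~ odd k.
Proof.
move=> + + alt; have q1 : (1 < q)%N by apply: card_finNzRing_gt1.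
have [r] := ubnP k; elim: r k U => // r IHr k U.
rewrite ltnS => ler Us Un cU.
have [/existsP[v /andP[vU v0]] | /existsPn H] := boolP [exists v, (v \in U) && (v != 0)].
  have [u0 u0U Bvu0] := Un v vU v0.
  pose u := (B v u0)^-1 *: u0.
  have uU : u \in U by apply: subspace_setZ.
  have Bvu : B v u = 1 by rewrite polarZr // mulVf.
  have cW := card_plane_perp Us vU uU (alt v) (alt u) Bvu.
  have Ws := plane_perp_subspace v u Us.
  have W_gt0 : (0 < #|plane_perp U v u|)%N by apply/card_gt0P; exists 0;
    case: Ws.
  have k2 : (1 < k)%N.
    rewrite ltnNge; apply/negP => k1.
    have : (q ^ k <= q ^ 1)%N by rewrite leq_exp2l.
    by rewrite -cU cW expn1; nia.
  rewrite -(subnK k2) oddD addbF; apply: (IHr _ (plane_perp U v u)) => //.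
  - by lia.
  - exact: plane_perp_nondegenerate.
  move: cW; rewrite cU -{1}(subnKC k2) expnD => /eqP.
  by rewrite eqn_pmul2l ?expn_gt0 ?(ltnW q1) // => /eqP->.
have /eqP := cU; have -> : #|U| = 1%N.
  apply/eqP/cards1P; exists 0; apply/setP=> x; rewrite inE.
  apply/idP/eqP => [xU|->]; last by case: Us.
  by have := H x; rewrite xU /= negbK => /eqP.
by case: k {ler cU} => // k; rewrite eq_sym expnS muln_eq1 gtn_eqF.
Qed.

End Splitting.

(** * Changes of variables and the radical of a nonsingular form *)

Lemma quadratic_form_mulmx (F : fieldType) (k n : nat) (Q : 'rV[F]_n -> F)
    (M : 'M[F]_(k, n)) :
  quadratic_form Q -> quadratic_form (fun y : 'rV[F]_k => Q (y *m M)).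
Proof.
move=> Qq.
have pE x y : polar (fun y => Q (y *m M)) x y = polar Q (x *m M) (y *m M).
  by rewrite /polar mulmxDl.
split=> [a v|u a x y|u a x y].
- by rewrite -scalemxAl qformZ.
- by rewrite !pE mulmxDl -scalemxAl polar_linear.
- by rewrite /= !pE mulmxDl -scalemxAl polarDl // polarZl.
Qed.

(** The matrix with all rows [v] sends the [i]-th unit vector to [v] without loss of rank, so some
    invertible matrix agrees with it on that vector. *)
Lemma exists_unitmx_row (F : fieldType) (n : nat) (i : 'I_n) (v : 'rV[F]_n) :
  v != 0 -> exists2 A : 'M[F]_n, A \in unitmx & row i A = v.
Proof.
move=> v0.
have rk : \rank ((delta_mx 0 i : 'rV[F]_n) *m (\matrix_(j < n) v)) =
          \rank (delta_mx 0 i : 'rV[F]_n).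
  by rewrite -rowE rowK rank_rV v0 mxrank_delta.
have [A uA] := complete_unitmx rk.
by rewrite -!rowE rowK => rA; exists A.
Qed.

(* A singular vector of the radical can be taken as the last basis vector; the
   form then does not depend on the last coordinate. *)
Lemma radical_qform_neq0 (F : fieldType) (n : nat) (Q : 'rV[F]_n -> F) v :
    quadratic_form Q -> nonsingular Q ->
  v != 0 -> (forall x, polar Q v x = 0) -> Q v != 0.
Proof.
case: n Q v => [|n] Q v Qq Qns v0 radv.
  by rewrite (thinmx0 v) eqxx in v0.
apply/eqP => Qv; apply: (Qns n (ltnSn n)).
have [A uA rA] := exists_unitmx_row ord_max v0.
exists A; split=> //.
exists (fun y => Q (y *m (pid_mx n *m A))); split.
  exact: quadratic_form_mulmx.
move=> x.
have -> : x = (\row_i x 0 (widen_ord (ltnW (ltnSn n)) i)) *m pid_mx n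
              + x 0 ord_max *: delta_mx 0 ord_max.
  apply/rowP => j; rewrite !mxE eqxx /=.
  have [->|jn] := eqVneq j ord_max.
    rewrite mulr1 big1 ?add0r // => i _.
    by rewrite !mxE /= ltn_eqF ?mulr0.
  have ltj : (j < n)%N.
    by rewrite ltn_neqAle -ltnS ltn_ord andbT; apply: contra jn => /eqP ej; apply/eqP/val_inj.
  rewrite mulr0 addr0 (bigD1 (Ordinal ltj)) //= big1 ?addr0.
    by rewrite !mxE eqxx ltj mulr1; congr (x 0 _); apply: val_inj.
  move=> i ij; rewrite !mxE; case: eqP => [e|]; last by rewrite mulr0.
  by case/eqP: ij; apply: val_inj.
set y := \row_i _; set y' := \row_i _.
have -> : y' = y.
  apply/rowP => j; rewrite !mxE /= (bigD1 j) //= big1; last first.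
    by move=> i ij; rewrite !mxE /= val_eqE (negPf ij) mulr0.
  rewrite !mxE /= eqxx ltn_ord mulr1 addr0 (_ : _ == ord_max = false) ?mulr0 ?addr0 //.
  by apply/eqP => /(congr1 val) /= e; have := ltn_ord j; rewrite e ltnn.
rewrite mulmxDl -scalemxAl -rowE rA qformD qformZ // Qv polarZr // polarC radv.
by rewrite !mulr0 !addr0 mulmxA.
Qed.

Section EvenDimension.

Variables (F : finFieldType) (n : nat) (Q : 'rV[F]_n -> F).
Hypotheses (Q_quad : quadratic_form Q) (Q_ns : nonsingular Q).
Hypothesis n_even : ~~ odd n.
Local Notation B := (polar Q).

(* In characteristic 2 squaring is bijective, so the radical has dimension at
   most 1; if it were a line, [B] would be a nondegenerate alternating form on
   a complement, which has odd dimension [n - 1]. *)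
Lemma nonsingular_nondegenerate : nondegenerate_on Q [set: 'rV[F]_n].
Proof.
move=> v _ v0; apply/exists_inP; apply: contraT => /exists_inPn radv'.
have radv x : B v x = 0 by apply/eqP; have := radv' x; rewrite inE negbK; apply.
have Qv := radical_qform_neq0 Q_quad Q_ns v0 radv.
have /eqP := radv v; rewrite polarxx // -mulr_natl mulf_eq0 (negPf Qv) orbF => /eqP two0.
have alt x : B x x = 0 by rewrite polarxx // -mulr_natl two0 mul0r.
have sqD (a b : F) : (a - b) ^+ 2 = a ^+ 2 - b ^+ 2.
  by transitivity (a ^+ 2 - b ^+ 2 - 2%:R * b * (a - b)); [ring | rewrite two0;
     ring].
have sq_inj : injective (fun a : F => a ^+ 2).
  move=> a b /= ab; apply/eqP; rewrite -subr_eq0 -sqrf_eq0 sqD ab subrr.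
  by [].
(* Squaring is injective on a finite set, hence onto, so [a ^+ 2 = Q x / Q v] has a solution. Then
   [x - a *: v] is in the radical with value [2 Q x = 0], and must vanish. *)
have rad_line x : (forall y, B x y = 0) -> exists a, x = a *: v.
  move=> radx; have /codomP[a Ea] := injF_onto sq_inj (Q x / Q v).
  exists a; apply/eqP; rewrite -subr_eq0; apply: contraT => xav.
  have := radical_qform_neq0 Q_quad Q_ns xav.
  rewrite qformB // qformZ // -Ea divfK // radx subr0 -mulr2n -mulr_natl two0 mul0r eqxx.
  by apply=> y; rewrite polarDl // polarNl // polarZl // radv radx mulr0 subr0.
have [i vi] : exists i, v 0 i != 0.
  apply/existsP; apply: contraNT v0 => /existsPn vi.
  by apply/eqP/rowP => i; have := vi i; rewrite mxE negbK => /eqP.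
pose U := [set x : 'rV[F]_n | x 0 i == 0].
have Us : subspace_set U.
  split=> [|a x y]; rewrite !inE !mxE // => /eqP-> /eqP->.
  by rewrite mulr0 addr0.
(* A multiple of the radical vector [v] moves any [y] into [U] without changing [B x y]. So an [x]
   in [U] orthogonal to [U] is in the radical, that is, on the line of [v], which meets [U] in 0. *)
have Un : nondegenerate_on Q U.
  move=> x xU x0; apply/exists_inP; apply: contraT => /exists_inPn Hx.
  have [|a xa] := rad_line x.
    move=> y; have := Hx (y - (y 0 i / v 0 i) *: v).
    rewrite inE !mxE divfK // subrr eqxx polarDr // polarNr // polarZr // polarC.
    by rewrite [B x v]polarC radv mulr0 subr0 negbK polarC => /(_ isT)/eqP.
  move: xU x0; rewrite inE xa mxE mulf_eq0 (negPf vi) orbF => /eqP->.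
  by rewrite scale0r eqxx.
have n_gt0 : (0 < n)%N by apply: leq_ltn_trans (leq0n i) (ltn_ord i).
have cU : #|U| = (#|F| ^ n.-1)%N.
  have phiL : scalar (fun x : 'rV[F]_n => x 0 i) by move=> a x y; rewrite !mxE.
  have vT : exists2 u, u \in [set: 'rV[F]_n] & u 0 i != 0 by exists v;
    rewrite ?inE.
  have := card_level_set 0 (subspace_setT _ _) phiL vT.
  have qnE : (#|F| ^ n = #|F| * #|F| ^ n.-1)%N by rewrite -expnS prednK.
  rewrite cardsT card_mx mul1n qnE => /eqP.
  rewrite eqn_pmul2l ?(ltnW (card_finNzRing_gt1 F)) // => /eqP <-.
  by apply: eq_card => x; rewrite !inE.
have := alternating_even_dim Q_quad Us Un alt cU.
by case: (n) n_gt0 n_even => //= k _; rewrite negbK => ->.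
Qed.

End EvenDimension.

(** * Hyperplane sections of quadrics and their behaviour under scaling *)

Section HyperplaneSections.

Variables (F : finFieldType) (n m : nat) (Q : 'rV[F]_n -> F).
Hypotheses (Q_quad : quadratic_form Q).
Hypothesis B_nondeg : nondegenerate_on Q [set: 'rV[F]_n].
Hypothesis n_even : n = m.*2.
Local Notation B := (polar Q).
Local Notation q := #|F|.
Local Notation V := [set: 'rV[F]_n].
Implicit Types (d w z : 'rV[F]_n) (a b c t l : F).

Lemma card_rV_even : #|V| = (q ^ m.*2)%N.
Proof. by rewrite cardsT card_mx mul1n n_even. Qed.

Lemma qcount_scale l c : l != 0 -> qcount Q V (l * c) = qcount Q V c.
Proof.
move=> l0; have [->|c0] := eqVneq c 0; first by rewrite mulr0.
apply: (qcount_const Q_quad) card_rV_even _ _ => //.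
- exact: subspace_setT.
- by rewrite mulf_neq0.
Qed.

(** A [z] with [B w z = t] is counted for all [b] or for none, according to [Q z = c]; any other [z]
    is counted for exactly one [b]. The second term on the left adds 1 for each [z] of the first
    kind, which avoids subtraction. *)
Lemma card_hyperplane_section w c t :
  (\sum_b qcount Q V (c + b * t + b ^+ 2 * Q w)%R
    + #|[set z in V | B w z == t]| =
   #|V| + q * #|[set z | (Q z == c) && (B w z == t)]|)%N.
Proof.
(* Translating by [b *: w] absorbs the term [b ^+ 2 * Q w] and leaves a condition affine in [b]. *)
have shift b : qcount Q V (c + b * t + b ^+ 2 * Q w) =
    (\sum_z (Q z + b * B w z == c + b * t)%R)%N.
  rewrite -card_set_sum -[RHS](card_imset _ (addIr (b *: w))).
  apply: eq_card => z; rewrite !inE /=; apply/idP/imsetP => [|[y]].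
    move=> Qz; exists (z - b *: w); last by rewrite subrK.
    rewrite inE qformB // (eqP Qz) qformZ // polarDr // polarNr // !polarZr //.
    by rewrite (polarxx Q_quad) polarC; apply/eqP; ring.
  rewrite inE => /eqP Qy ->; rewrite qformD qformZ // polarZr // polarC.
  by rewrite addrAC Qy.
rewrite (eq_bigr _ (fun b _ => shift b)) exchange_big /=.
have -> : [set z in V | B w z == t] = [set z | B w z == t].
  by apply/setP=> z; rewrite !inE.
rewrite cardsT !card_set_sum -sum1_card big_distrr -!big_split /=.
apply: eq_bigr => z _.
have [<-|Bwz] := eqVneq (B w z) t.
  rewrite andbT (eq_bigr (fun=> (Q z == c : nat))).
    by rewrite sum_nat_const addnC.
  by move=> b _; rewrite (inj_eq (addIr _)).
rewrite andbF muln0 !addn0 (bigD1 ((c - Q z) / (B w z - t))) //= big1.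
  have nz : B w z - t != 0 by rewrite subr_eq0.
  have := divfK nz (c - Q z); set b := _ / _ => e.
  have -> : Q z + b * B w z = c + b * t.
    by rewrite -[c](subrK (Q z)) -e; ring.
  by rewrite eqxx.
move=> b /eqP bn; apply/eqP; rewrite eqb0; apply/eqP => e; apply: bn.
apply: (canRL (mulfK _)); first by rewrite subr_eq0.
by rewrite mulrBr; apply/eqP; rewrite -subr_eq0; apply/eqP;
   transitivity (Q z + b * B w z - (c + b * t)); [ring | rewrite e subrr].
Qed.

(** Each argument [c + b * t + b ^+ 2 * Q w] gets multiplied by [l], which keeps its [qcount], and
    the two hyperplanes have equal size. So the other terms of [card_hyperplane_section] agree. *)
Lemma card_hyperplane_section_scale w w' l c t :
    w != 0 -> w' != 0 -> l != 0 -> Q w' = l * Q w ->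
  #|[set z | (Q z == l * c) && (B w' z == l * t)]| =
  #|[set z | (Q z == c) && (B w z == t)]|.
Proof.
move=> w0 w'0 l0 Qw'.
have q_gt0 : (0 < q)%N := ltnW (card_finNzRing_gt1 F).
have H u s : u != 0 -> (q * #|[set z in V | B u z == s]| = #|V|)%N.
  by move=> u0; apply: card_hyperplane (subspace_setT _ _) (B_nondeg _ u0) => //; rewrite inE.
have HH : #|[set z in V | B w' z == l * t]| = #|[set z in V | B w z == t]|.
  by apply/eqP; rewrite -(eqn_pmul2l q_gt0) !H.
have := card_hyperplane_section w' (l * c) (l * t).
rewrite HH (eq_bigr (fun b => qcount Q V (c + b * t + b ^+ 2 * Q w))).
  rewrite card_hyperplane_section => /eqP.
  by rewrite eqn_add2l eqn_pmul2l // => /eqP.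
move=> b _; rewrite -[RHS](qcount_scale _ l0) Qw'; congr (qcount Q V _); ring.
Qed.

(** The points [0] and [d] are left out because the zero vector belongs to the diagonal relation,
    not to the graph of value 0. *)
Definition pair_count d a b : nat :=
  #|[set z | [&& z != 0, z != d, Q z == a & Q (d - z) == b]]|.

(** Given [Q z = r], the condition [Q (u - z) = s] becomes [B u z = Q u + r - s]. A pair count is
    thus a hyperplane section corrected at [z = 0] and [z = u], and the corrections are unchanged
    when all values are scaled by [l]. *)
Lemma pair_count_scale d d' l a b :
    d != 0 -> d' != 0 -> l != 0 -> Q d' = l * Q d ->
  pair_count d' (l * a) (l * b) = pair_count d a b.
Proof.
move=> d0 d'0 l0 Qd'.
have E u r s : u != 0 ->
    (pair_count u r s + ((r == 0) && (s == Q u))%R + ((r == Q u) && (s == 0))%R =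
     #|[set z | (Q z == r) && (B u z == Q u + r - s)%R]|)%N.
  move=> u0; set S := [set z | _].
  have S0 : (0 \in S) = (r == 0) && (s == Q u).
    rewrite inE qform0 // polarv0 // eq_sym; case: eqP => //= ->.
    by rewrite addr0 eq_sym subr_eq0 eq_sym.
  have Su : (u \in S :\ 0) = (r == Q u) && (s == 0).
    rewrite !inE u0 /= polarxx // eq_sym; case: eqP => //= ->.
    by rewrite mulr2n eq_sym -subr_eq0 addrAC subrr add0r oppr_eq0.
  rewrite (cardsD1 0 S) (cardsD1 u (S :\ 0)) S0 Su addnA [RHS]addnC addnA.
  congr (_ + _ + _)%N; apply: eq_card => z; rewrite !inE andbCA.
  congr [&& _, _ & _]; case: eqP => //= <-; rewrite qformB //.
  by apply/eqP/eqP => [<-|->]; ring.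
have H : #|[set z | (Q z == l * a) && (B d' z == l * (Q d + a - b))]| =
   #|[set z | (Q z == a) && (B d z == Q d + a - b)]|.
  exact: card_hyperplane_section_scale.
have lI := inj_eq (mulfI l0).
have := E d' (l * a) (l * b) d'0.
have -> : Q d' + l * a - l * b = l * (Q d + a - b) by rewrite Qd'; ring.
rewrite H -E // Qd' !lI !(mulf_eq0 l) !(negPf l0) /= => /eqP.
by rewrite !eqn_add2r => /eqP.
Qed.

(** If one nonzero value is missed, scaling shows that all are; then [Q] and its polar form vanish,
    against nondegeneracy. *)
Lemma qcount_gt0 c : c != 0 -> (0 < n)%N -> (0 < qcount Q V c)%N.
Proof.
move=> c0 n_gt0; rewrite lt0n; apply/eqP => Qc0.
have Q0 x : Q x = 0.
  apply: contraTeq isT => Qx; have : (0 < qcount Q V (Q x))%N.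
    by apply/card_gt0P; exists x; rewrite !inE eqxx.
  by rewrite -[Q x](divfK c0) qcount_scale ?Qc0 // mulf_neq0 ?invr_neq0.
have v0 : (const_mx 1 : 'rV[F]_n) != 0.
  by apply/eqP => /rowP/(_ (Ordinal n_gt0)); rewrite !mxE; apply/eqP;
     rewrite oner_eq0.
have [x _] := B_nondeg (in_setT _) v0.
by rewrite /polar !Q0 !subr0 eqxx.
Qed.

(** An anisotropic form would give [q ^ m.*2.-1 = q], hence [m = 1]. *)
Lemma exists_singular : (1 < m)%N -> exists2 x, x != 0 & Q x = 0.
Proof.
move=> m1; have q1 := card_finNzRing_gt1 F.
have [/forallP Ua|/forallPn[x]] := boolP [forall x, (Q x == 0) ==> (x == 0)].
  have anis x : x \in V -> Q x = 0 -> x = 0.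
    by move=> _ /eqP Qx; apply/eqP; have := Ua x; rewrite Qx.
  have cV : #|V| = (q * q ^ m.*2.-1)%N by rewrite card_rV_even -expnS prednK //; lia.
  have [|e _] := qcount_anisotropic Q_quad (subspace_setT _ _) B_nondeg anis cV.
    by rewrite -{1}(expn1 q) leq_exp2l //; lia.
  move/eqP: e; rewrite -{2}(expn1 q) eqn_exp2l // => /eqP e.
  by move: e m1; lia.
by rewrite negb_imply => /andP[/eqP Qx x0]; exists x.
Qed.

End HyperplaneSections.

(** * Association schemes from partitions of the field compatible with scaling *)

Section ValueSchemes.

Variables (F : finFieldType) (n m : nat) (Q : 'rV[F]_n -> F).
Hypotheses (Q_quad : quadratic_form Q).
Hypothesis B_nondeg : nondegenerate_on Q [set: 'rV[F]_n].
Hypothesis n_even : n = m.*2.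

Variables (d : nat) (T : 'I_d -> {set F}).
Hypothesis T_partition : forall c, exists! j, c \in T j.
Hypothesis T_scale : forall j c c', c \in T j -> c' \in T j ->
  exists l, [/\ l != 0, c' = l * c
    & forall k a, a \in T k -> l * a \in T k].

Variable G : 'I_d -> rel 'rV[F]_n.
Hypothesis GE : forall j x y, G j x y = (x != y) && (Q (x - y) \in T j).

Local Notation R := (graph_relations G).

Lemma value_part_inj c i j : c \in T i -> c \in T j -> i = j.
Proof.
move=> ci cj; have [k [_ kU]] := T_partition c.
exact: etrans (esym (kU i ci)) (kU j cj).
Qed.

Lemma in_relation0 x y : ((x, y) \in R ord0) = (x == y).
Proof. by rewrite /graph_relations unlift_none inE. Qed.

Lemma in_relationS j x y :
  ((x, y) \in R (lift ord0 j)) = (x != y) && (Q (x - y) \in T j).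
Proof. by rewrite /graph_relations liftK inE GE. Qed.

Lemma relation_partition x y : exists! i, (x, y) \in R i.
Proof.
have [->|xy] := eqVneq x y.
  exists ord0; split=> [|i]; first by rewrite in_relation0.
  case: (unliftP ord0 i) => [j|] -> //.
  by rewrite in_relationS eqxx.
have [j [Tj jU]] := T_partition (Q (x - y)).
exists (lift ord0 j); split=> [|i]; first by rewrite in_relationS xy.
case: (unliftP ord0 i) => [k|] ->; last by rewrite in_relation0 (negPf xy).
by rewrite in_relationS xy => /jU->.
Qed.

Lemma relation_sym i x y : (x, y) \in R i -> (y, x) \in R i.
Proof.
case: (unliftP ord0 i) => [j|] ->; last by rewrite !in_relation0 eq_sym.
by rewrite !in_relationS eq_sym -(opprB x y) qformN.
Qed.

Lemma relation_translate i x y z : ((x, y) \in R i) = ((x - z, y - z) \in R i).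
Proof.
case: (unliftP ord0 i) => [j|] ->;
  rewrite ?in_relation0 ?in_relationS (inj_eq (addIr _)) //.
by rewrite opprB addrA subrK.
Qed.

Lemma relation_uniq i j x y : (x, y) \in R i -> ((x, y) \in R j) = (i == j).
Proof.
move=> Ri; apply/idP/eqP => [Rj|<- //].
by have [k [_ kU]] := relation_partition x y;
   apply: etrans (esym (kU i Ri)) (kU j Rj).
Qed.

(** If neither relation is diagonal, each side sums [pair_count] over the pairs of values in [T j']
    and [T i']. The [l] of [T_scale] takes [Q e] to [Q e'] and preserves every part, so it permutes
    these pairs, and [pair_count_scale] matches the terms. *)
Lemma card_intersection i j e e' k :
    (e, 0) \in R (lift ord0 k) -> (e', 0) \in R (lift ord0 k) ->
  #|[set z | ((e, z) \in R i) && ((z, 0) \in R j)]| =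
  #|[set z | ((e', z) \in R i) && ((z, 0) \in R j)]|.
Proof.
move=> Re Re'.
case: (unliftP ord0 i) => [i'|] ->; last first.
  have H u : (u, 0) \in R (lift ord0 k) ->
      #|[set z | ((u, z) \in R ord0) && ((z, 0) \in R j)]| = (lift ord0 k == j).
    move=> Ru; rewrite -(relation_uniq j Ru).
    transitivity #|[set z in [set u] | (u, 0) \in R j]|.
      by apply: eq_card => z; rewrite !inE in_relation0 eq_sym;
         case: eqP => // ->.
    exact: card_set1_cond.
  by rewrite !H.
case: (unliftP ord0 j) => [j'|] ->; last first.
  have H u : (u, 0) \in R (lift ord0 k) ->
      #|[set z | ((u, z) \in R (lift ord0 i')) && ((z, 0) \in R ord0)]| = (k == i').
    move=> Ru; rewrite -(inj_eq (@lift_inj _ ord0)) -(relation_uniq (lift ord0 i') Ru).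
    transitivity #|[set z in [set (0 : 'rV[F]_n)] | (u, 0) \in R (lift ord0 i')]|.
      by apply: eq_card => z; rewrite !inE in_relation0 andbC;
         case: eqP => // ->.
    exact: card_set1_cond.
  by rewrite !H.
move: Re Re'; rewrite !in_relationS !subr0 => /andP[e0 Te] /andP[e'0 Te'].
have [l [l0 Qe' Tl]] := T_scale Te Te'.
(* For the converse, [a] lies in some part, which also contains [l * a], and the parts are
   disjoint. *)
have TlE h a : (l * a \in T h) = (a \in T h).
  apply/idP/idP => [la|]; last exact: Tl.
  have [h' [ah' _]] := T_partition a.
  by rewrite (value_part_inj la (Tl _ _ ah')).
have H u : #|[set z | ((u, z) \in R (lift ord0 i')) && ((z, 0) \in R (lift ord0 j'))]| =
    (\sum_(p : F * F) if (p.1 \in T j') && (p.2 \in T i')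
                     then pair_count Q u p.1 p.2 else 0)%N.
  rewrite (card_fibers _ (fun z => (Q z, Q (u - z))));
    apply: eq_bigr => -[a b] _ /=.
  case: ifP => ab; last first.
    apply/eqP; rewrite cards_eq0; apply/eqP/setP => z; rewrite !inE.
    rewrite !in_relationS !subr0;
      apply/negP => /andP[/andP[/andP[_ Ti] /andP[_ Tj]]].
    by move=> /eqP[Ea Eb]; rewrite -Ea -Eb Ti Tj in ab.
  apply: eq_card => z; rewrite !inE !in_relationS !subr0 xpair_eqE.
  rewrite [u == z]eq_sym; case: (z != u); rewrite /= ?andbF //.
  case: (z != 0); rewrite /= ?andbF //; apply/idP/idP => [/andP[] //|H].
  by have /andP[/eqP-> /eqP->] := H; rewrite andbC !eqxx /=;
     move: ab => /andP[-> ->].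
rewrite !H [RHS](reindex (fun p : F * F => (l * p.1, l * p.2))) /=.
  apply: eq_bigr => -[a b] _ /=; rewrite !TlE.
  by rewrite (pair_count_scale Q_quad B_nondeg n_even _ _ e0 e'0 l0 Qe').
exists (fun p => (l^-1 * p.1, l^-1 * p.2)) => -[a b] _ /=.
  by rewrite !mulKf.
by rewrite !mulVKf.
Qed.

Lemma value_partition_scheme : gives_assoc_scheme G.
Proof.
split.
- by apply/setP=> -[x y]; rewrite in_relation0 inE.
- exact: relation_partition.
- exact: relation_sym.
move=> i j k.
have E x y : #|[set z | ((x, z) \in R i) && ((z, y) \in R j)]| =
    #|[set z | ((x - y, z) \in R i) && ((z, 0) \in R j)]|.
  rewrite -[RHS](card_imset _ (addIr y)); apply: eq_card => z.
  rewrite inE; apply/idP/imsetP => [|[t]].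
    rewrite (relation_translate i _ _ y) (relation_translate j _ _ y) subrr => H.
    by exists (z - y); rewrite ?inE ?subrK.
  rewrite inE => H ->.
  by rewrite (relation_translate i _ _ y) (relation_translate j _ _ y) subrr addrK.
(* For an empty relation any constant serves; 0 is chosen. *)
case: (pickP [pred u | u \in R k]) => [[x0 y0] /= Rk | Rk]; last first.
  by exists 0%N => x y Rxy; have := Rk (x, y); rewrite /= Rxy.
exists #|[set z | ((x0, z) \in R i) && ((z, y0) \in R j)]| => x y Rxy.
rewrite [LHS]E [RHS]E; move: Rk Rxy.
rewrite (relation_translate _ _ _ y0) subrr (relation_translate k x y y) subrr.
case: (unliftP ord0 k) => [k'|] -> Rk Rxy;
  first exact: card_intersection Rxy Rk.
by move: Rk Rxy; rewrite !in_relation0 => /eqP-> /eqP->.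
Qed.

End ValueSchemes.

(** * Cyclotomic classes in the multiplicative group *)

Section CyclotomicClasses.

Variables (F : finFieldType) (w : {unit F}) (e : nat).
Hypothesis w_gen : generator [set: {unit F}] w.
Hypothesis e_dvd : (e %| #|F|.-1)%N.
Local Notation g := (FinRing.uval w).

Lemma order_primitive : #[w]%g = #|F|.-1.
Proof.
by rewrite -card_finField_unit orderE; move: w_gen;
   rewrite /generator => /eqP <-.
Qed.

Lemma primitive_neq0 : g != 0.
Proof. by rewrite -unitfE; apply: (valP w). Qed.

Lemma primitive_power c : c != 0 -> exists a, c = g ^+ a.
Proof.
move=> c0; have uc : c \is a GRing.unit by rewrite unitfE.
have : FinRing.unit F uc \in <[w]>%g.
  by move: w_gen; rewrite /generator => /eqP <-; rewrite inE.
move=> /cycleP[a /(congr1 val)]; rewrite FinRing.val_unitX => /= ->.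
by exists a.
Qed.

(** Exponents of [g] are determined modulo [#|F|.-1], hence modulo its divisor [e]. *)
Lemma primitive_power_eq a b : g ^+ a = g ^+ b -> a = b %[mod e].
Proof.
rewrite -!FinRing.val_unitX => /val_inj/eqP.
rewrite eq_expg_mod_order order_primitive => /eqP ab.
by rewrite -(modn_dvdm a e_dvd) ab modn_dvdm.
Qed.

Lemma cyclotomic_classP i c :
  reflect (exists k, c = g ^+ (i + e * k)) (c \in cyclotomic_class w e i).
Proof.
apply: (iffP imsetP) => [[u /lcosetP[x /cycleP[k ->] ->] ->]|[k ->]].
  by exists k; rewrite -expgM -expgD FinRing.val_unitX.
exists (w ^+ (i + e * k))%g; last by rewrite FinRing.val_unitX.
by apply/lcosetP; exists ((w ^+ e) ^+ k)%g; rewrite ?mem_cycle // -expgM expgD.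
Qed.

Lemma cyclotomic_class_neq0 i c : c \in cyclotomic_class w e i -> c != 0.
Proof. by case/cyclotomic_classP => k ->;
  rewrite expf_neq0 // primitive_neq0. Qed.

Lemma cyclotomic_class_partition c :
  c != 0 -> exists! i : 'I_e, c \in cyclotomic_class w e i.
Proof.
move=> /primitive_power[a ->].
have e_gt0 : (0 < e)%N.
  by apply: (dvdn_gt0 _ e_dvd); rewrite -subn1 subn_gt0 card_finNzRing_gt1.
exists (Ordinal (ltn_pmod a e_gt0)); split=> [|i /cyclotomic_classP[k]].
  by apply/cyclotomic_classP; exists (a %/ e)%N;
     rewrite /= mulnC addnC -divn_eq.
move=> /primitive_power_eq; rewrite addnC mulnC modnMDl => ai.
by apply: val_inj; rewrite /= ai modn_small.
Qed.

(** The multiplier [c' / c] is a power of [g ^+ e], and such a factor maps every class to itself. *)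
Lemma cyclotomic_class_scale i c c' :
    c \in cyclotomic_class w e i -> c' \in cyclotomic_class w e i ->
  exists l, [/\ l != 0, c' = l * c
    & forall k a, a \in cyclotomic_class w e k -> l * a \in cyclotomic_class w e k].
Proof.
move=> ci /cyclotomic_classP[k' ->]; have c0 := cyclotomic_class_neq0 ci.
case/cyclotomic_classP: ci c0 => k -> c0; have g0 := primitive_neq0.
have q1 := card_finNzRing_gt1 F.
have gN : g ^+ #|F|.-1 = 1.
  by rewrite -order_primitive -FinRing.val_unitX expg_order.
(* As [g ^+ #|F|.-1 = 1], the factor [#|F|.-2] acts as -1 in the exponent: this is [g] to the power
   [e (k' - k)], written with natural numbers. *)
exists (g ^+ (e * (k' + #|F|.-2 * k))); split.
- by rewrite expf_neq0.
- rewrite -exprD.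
  have -> : (e * (k' + #|F|.-2 * k) + (i + e * k) = i + e * k' + #|F|.-1 * (e * k))%N.
    have -> : #|F|.-1 = #|F|.-2.+1.
      by rewrite prednK // -subn1 subn_gt0.
    by rewrite mulSn; ring.
  by rewrite [RHS]exprD exprM gN expr1n mulr1.
move=> j a /cyclotomic_classP[h ->]; apply/cyclotomic_classP.
exists (k' + #|F|.-2 * k + h)%N; rewrite -exprD; congr (_ ^+ _); ring.
Qed.

End CyclotomicClasses.

(* The second conjunct says that the e + 1 classes are nonempty; the only
   exception is D_0 \ {0} when n = 2, which is empty for anisotropic Q. *)
Theorem theorem5p1 (p f q m n e : nat) (F : finFieldType)
    (p_prime : prime p) (f_gt0 : (0 < f)%N) (qE : q = (p ^ f)%N)
    (cardF : #|F| = q)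
    (m_gt0 : (0 < m)%N) (nE : n = (2 * m)%N)
    (Q : 'rV[F]_n -> F) (Q_quad : quadratic_form Q) (Q_ns : nonsingular Q)
    (e_dvd : (e %| q - 1)%N)
    (w : {unit F}) (w_prim : generator [set: {unit F}] w) :
  gives_assoc_scheme (@quadric_graphs F n Q w e) /\
  (forall i : 'I_e.+1, i != ord0 \/ (1 < m)%N ->
     exists x y : 'rV[F]_n, quadric_graphs Q w i x y).
Proof.
have n_even : n = m.*2 by rewrite nE mul2n.
have B_nondeg : nondegenerate_on Q [set: 'rV[F]_n].
  by apply: nonsingular_nondegenerate => //; rewrite n_even odd_double.
have e_dvdF : (e %| #|F|.-1)%N by rewrite cardF -subn1.
(* The field is split into [{0}] and the [e] cyclotomic classes, indexed like the graphs. *)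
pose T (j : 'I_e.+1) : {set F} :=
  if unlift ord0 j is Some k then cyclotomic_class w e k else [set 0].
have T0 : T ord0 = [set 0] by rewrite /T unlift_none.
have TS k : T (lift ord0 k) = cyclotomic_class w e k by rewrite /T liftK.
split.
  apply: (@value_partition_scheme F n m Q Q_quad B_nondeg n_even e.+1 T).
  - move=> c; have [->|c0] := eqVneq c 0.
      exists ord0; split=> [|j]; first by rewrite T0 inE.
      case: (unliftP ord0 j) => [k|] -> //; rewrite TS.
      by move/cyclotomic_class_neq0; rewrite eqxx.
    have [k [ck kU]] := cyclotomic_class_partition w_prim e_dvdF c0.
    exists (lift ord0 k); split=> [|j]; first by rewrite TS.
    case: (unliftP ord0 j) => [k'|] ->; last by rewrite T0 inE (negPf c0).
    by rewrite TS => /kU->.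
  - move=> j c c'; case: (unliftP ord0 j) => [k|] ->; last first.
      rewrite T0 !inE => /eqP-> /eqP->; exists 1.
      by rewrite oner_neq0 mulr0; split=> // h a; rewrite mul1r.
    rewrite TS => ck c'k;
      have [l [l0 c'E Hl]] := cyclotomic_class_scale w_prim ck c'k.
    exists l; split=> // h a; case: (unliftP ord0 h) => [h'|] ->.
      by rewrite TS; apply: Hl.
    by rewrite T0 !inE => /eqP->; rewrite mulr0.
  move=> j x y; rewrite /quadric_graphs -(subr_eq0 x y).
  case: (unliftP ord0 j) => [k|] ->;
    rewrite ?liftK ?unlift_none /cayley /= ?TS ?T0 !inE //.
  (* Since [Q 0 = 0] is in no cyclotomic class, [x != y] is automatic for these graphs. *)
  case: eqP => // ->; rewrite qform0 //.
  by apply/negP => /cyclotomic_class_neq0; rewrite eqxx.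
move=> i; case: (unliftP ord0 i) => [k|] ->;
  rewrite /quadric_graphs ?liftK ?unlift_none.
  move=> _; pose c := FinRing.uval w ^+ (k + e * 0).
  have ck : c \in cyclotomic_class w e k by apply/cyclotomic_classP; exists 0%N.
  have n_gt0 : (0 < n)%N by rewrite nE muln_gt0.
  have /card_gt0P[x] := qcount_gt0 Q_quad B_nondeg n_even (cyclotomic_class_neq0 ck) n_gt0.
  by rewrite !inE => /eqP Qx; exists x, 0; rewrite /cayley /= subr0 inE Qx.
case=> [|m1]; first by rewrite eqxx.
have [x x0 Qx] := exists_singular Q_quad B_nondeg n_even m1.
by exists x, 0; rewrite /cayley /= subr0 !inE x0 Qx /=.
Qed.
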